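(* Let $\delta \geq 2$. If $Q$ is a $\delta$-colourable quadruple system of order $v$, then there is a $K(Q)$ which is a $2\delta$-colourable Kirkman triple system of order $2v+1$.
   Context: A quadruple system of order $v$ is a set of $v$ points with a set of $4$-subsets (blocks) such that each pair of points lies in exactly one block. Given a quadruple system $Q$ on points $\{q_0,\dots,q_{v-1}\}$, a $K(Q)$ is a Kirkman triple system (Steiner triple system with a partition of its triples into parallel classes) on $\{\infty\}\cup\{q_i,q_i' : 0\le i\le v-1\}$ obtained by placing, for each block $\{w,x,y,z\}$ of $Q$, the triples of a KTS$(9)$ on $\{\infty,w,x,y,z,w',x',y',z'\}$ so that the triples containing $\infty$ are $\{\infty,w,w'\},\{\infty,x,x'\},\{\infty,y,y'\},\{\infty,z,z'\}$ (the placement is not unique). A design is $\delta$-colourable if there is a map from its points to a set of $\delta$ colours with no monochromatic block.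
   Formalization: The order v = 1 is excluded: a single point with no blocks vacuously meets the definition of a quadruple system, but then no triples are placed, the pair {q, q'} is uncovered, and no K(Q) exists. *)

(* Defs.v *)
From mathcomp Require Export all_boot.
Set Implicit Arguments. Unset Strict Implicit. Unset Printing Implicit Defensive.

Section Designs.
Variable U : finType.
Implicit Types (D : {set U}) (B C : {set {set U}}) (R : {set {set {set U}}}).

(* Steiner system S(2, k, #|D|) with point set D and block set B *)
Definition steiner (k : nat) D B : Prop :=
  (forall b, b \in B -> b \subset D /\ #|b| = k) /\
  (forall x y, x \in D -> y \in D -> x != y ->
     #|[set b in B | (x \in b) && (y \in b)]| = 1).

Definition quadruple_system (v : nat) D B : Prop :=
  #|D| = v /\ steiner 4 D B.

(* R is the set of parallel classes: it partitions the triples, and each of its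
   members partitions the points *)
Definition kirkman_triple_system (n : nat) D B R : Prop :=
  [/\ #|D| = n,
      steiner 3 D B,
      partition R B
    & forall C, C \in R -> partition C D].

Definition monochromatic (d : nat) (c : U -> 'I_d) (b : {set U}) : Prop :=
  exists i, forall x, x \in b -> c x = i.

Definition colourable (d : nat) B : Prop :=
  exists c : U -> 'I_d, forall b, b \in B -> ~ monochromatic c b.

End Designs.

Section KQ.
Variable T : finType.

Definition kq_point : finType := option (T * bool).
Definition infty : kq_point := None.
Definition unprimed (q : T) : kq_point := Some (q, false).
Definition primed (q : T) : kq_point := Some (q, true).

Definition kq_triple (q : T) : {set kq_point} :=
  [set infty; unprimed q; primed q].

Definition kq_block_points (b : {set T}) : {set kq_point} :=
  infty |: ([set unprimed q | q in b] :|: [set primed q | q in b]).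

Definition kts9_placement (b : {set T}) (N : {set {set kq_point}}) : Prop :=
  (exists S, kirkman_triple_system 9 (kq_block_points b) N S) /\
  [set t in N | infty \in t] = [set kq_triple q | q in b].

(* The Kirkman triple system with triples B and parallel classes R is a K(Q) *)
Definition is_KQ (Q : {set {set T}}) (B : {set {set kq_point}})
    (R : {set {set {set kq_point}}}) : Prop :=
  kirkman_triple_system #|kq_point| [set: kq_point] B R /\
  exists N : {set T} -> {set {set kq_point}},
    (forall b, b \in Q -> kts9_placement b (N b)) /\
    B = \bigcup_(b in Q) N b.

End KQ.

(* Main.v *)
(** The triples of [AG(2,3)] missing the origin [oo] come in antipodal pairs:
    for each direction [i], the two lines parallel to [i] contain one point of
    each of the three other directions, with opposite signs.  Hence a placement
    of a KTS(9) on a block [b] amounts to a sign table [sg : T -> T -> bool],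
    the lines parallel to [i] being [{(j, s (+) sg i j) : j in b, j <> i}], and
    these form a KTS(9) as soon as, for [j <> k] in [b], the two possible [i]
    disagree on [sg i j (+) sg i k].  Glueing over all blocks the classes of
    direction [q] gives a parallel class for each point [q].

    Colour [q] by [(c q, 0)] and [q'] by [(c q, 1)].  The table can be chosen
    so that only one of its rows is constant, at any prescribed point [x] of
    the block.  As [c] is not constant on [b], one may choose [x] so that [c] is
    not constant on [b :\ x]; then no triple is monochromatic. *)

Require Import Defs.
From mathcomp Require Import all_boot.

Set Implicit Arguments. Unset Strict Implicit. Unset Printing Implicit Defensive.

(** * Partitions and Steiner systems *)

Section Steiner.
Variable U : finType.

Lemma partition_unique (P : {set {set U}}) (D : {set U}) :
  (forall A, A \in P -> A \subset D /\ A != set0) ->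
  (forall x, x \in D -> exists2 A, A \in P & x \in A) ->
  (forall A B x, A \in P -> B \in P -> x \in A -> x \in B -> A = B) ->
  partition P D.
Proof.
move=> sub ex un; apply/and3P; split.
- rewrite eqEsubset; apply/andP; split; apply/subsetP => x.
    by move/bigcupP => [A AP xA]; have [/subsetP -> ] := sub _ AP.
  by move/ex => [A AP xA]; apply/bigcupP; exists A.
- apply/trivIsetP => A B AP BP /eqP neAB; apply/pred0P => x /=.
  by apply/negP => /andP [xA xB]; apply: neAB; apply: un xA xB.
- by apply/negP => /sub [_ /eqP].
Qed.

Lemma steiner_block_ex k (D : {set U}) Q x y : steiner k D Q ->
  x \in D -> y \in D -> x != y -> exists b, [/\ b \in Q, x \in b & y \in b].
Proof.
move=> [_ st] xD yD nexy; have /eqP/cards1P [b E] := st x y xD yD nexy.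
by exists b; have := set11 b; rewrite -E inE => /and3P [].
Qed.

Lemma steiner_block_inj k (D : {set U}) Q x y b b' : steiner k D Q ->
  x != y -> b \in Q -> b' \in Q -> x \in b -> y \in b -> x \in b' -> y \in b' ->
  b = b'.
Proof.
move=> [sub st] nexy bQ b'Q xb yb xb' yb'.
have [/subsetP bD _] := sub b bQ.
have /eqP/cards1P [a E] := st x y (bD _ xb) (bD _ yb) nexy.
have : b \in [set a] by rewrite -E inE bQ xb yb.
have : b' \in [set a] by rewrite -E inE b'Q xb' yb'.
by rewrite !inE => /eqP -> /eqP ->.
Qed.

(** Lets the construction made for the whole system be reused on a single block, where it yields the
    KTS(9) placed there. *)
Lemma steiner_restrict k (D : {set U}) Q b :
  steiner k D Q -> b \in Q -> steiner k b [set b].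
Proof.
move=> [sub _] bQ; split=> [b' /set1P ->|x y xb yb _].
  by have [_ ->] := sub b bQ.
apply/eqP/cards1P; exists b; apply/setP => b'; rewrite !inE.
by case: eqP => //= ->; rewrite xb yb.
Qed.

End Steiner.

(** * Sign tables on a block of four points *)

Section SignTable.
Variable T : finType.

(** Here [e] stands for the sum of the signs of two points over [j] and [k], and [i] is the
    direction of the one line that joins them. *)
Definition sign_table (b : {set T}) (sg : T -> T -> bool) : Prop :=
  forall j k e, j \in b -> k \in b -> j != k ->
    exists i, forall i',
      [&& i' \in b, i' != j, i' != k & sg i' j (+) sg i' k == e] = (i' == i).

(* Row 0 is constant; rows 1, 2, 3 have a single [true], placed cyclically. *)
Definition sign4 (i j : nat) : bool := (i, j) \in [:: (1, 2); (2, 3); (3, 1)].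

Lemma sign4_table j k e : j < 4 -> k < 4 -> j != k ->
  exists2 i, i < 4 & forall i', i' < 4 ->
    [&& i' != j, i' != k & sign4 i' j (+) sign4 i' k == e] = (i' == i).
Proof.
move=> j4 k4 nejk.
(* Stated over [iota 0 4], the claim is decided by evaluation once [j], [k] and [e] are concrete. *)
suff /hasP [i]: has (fun i => all (fun i' =>
    [&& i' != j, i' != k & sign4 i' j (+) sign4 i' k == e] == (i' == i))
    (iota 0 4)) (iota 0 4).
  rewrite mem_iota => i4 /allP H; exists i => // i' i'4.
  by apply/eqP/H; rewrite mem_iota.
by move: j k e j4 k4 nejk => [|[|[|[|j]]]] [|[|[|[|k]]]] [].
Qed.

Lemma sign4_row i : 0 < i < 4 ->
  exists j k, [&& j < 4, k < 4, j != i, k != i & sign4 i j != sign4 i k].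
Proof.
(* Column 0 is false in every row; it is paired with the column of the single [true] of row [i]. *)
case: i => [|[|[|[|i]]]] // _; first by exists 0, 2.
  by exists 0, 3.
by exists 0, 1.
Qed.

Lemma sign_table_ex (b : {set T}) x : #|b| = 4 -> x \in b ->
  exists2 sg, sign_table b sg &
    forall i, i \in b -> i != x ->
      exists j k, [/\ j \in b :\ i, k \in b :\ i & sg i j != sg i k].
Proof.
(* Listing [x] first gives it index 0, so the constant row of [sign4] falls on [x]. *)
move=> b4 xb; pose s := x :: enum (b :\ x).
have us : uniq s by rewrite /= enum_uniq mem_enum !inE eqxx.
have mems i : (i \in s) = (i \in b).
  by rewrite in_cons mem_enum !inE; case: eqP => // ->.
have szs : size s = 4 by rewrite /= -cardE (cardsD1 x b) xb in b4 *.
have ix i : i \in b -> index i s < 4 by rewrite -szs index_mem mems.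
have nthb i : i < 4 -> nth x s i \in b by rewrite -mems -szs; apply: mem_nth.
have inxE i : i < 4 -> index (nth x s i) s = i by rewrite -szs => ?; rewrite index_uniq.
have ixE i j : i \in b -> (index i s == index j s) = (i == j).
  move=> ib; apply/eqP/eqP => [E|-> //].
  by apply: (index_inj x _ _ E); rewrite -index_mem ?E szs -?E ix.
exists (fun i j => sign4 (index i s) (index j s)).
  move=> j k e jb kb nejk.
  have [i i4 iP] := @sign4_table (index j s) (index k s) e (ix _ jb) (ix _ kb)
    (etrans (congr1 negb (ixE _ _ jb)) nejk).
  exists (nth x s i) => i'; have [i'b|i'b] := boolP (i' \in b).
    by rewrite andTb -!ixE // inxE // -(iP _ (ix _ i'b)).
  by apply/esym/negP => /eqP E; rewrite E nthb in i'b.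
move=> i ib neix.
have [|j [k /and5P [j4 k4 ji ki ne]]] := @sign4_row (index i s).
  by rewrite ix // andbT /= eq_sym (negbTE neix).
exists (nth x s j), (nth x s k).
by rewrite !inE -!ixE ?nthb // !inxE // ji ki.
Qed.

End SignTable.

(** * The Kirkman triple system built from sign tables *)

Section Construction.
Variable T : finType.
Implicit Types (b D : {set T}) (Q : {set {set T}}) (t : {set kq_point T}).

Definition signed_line (sg : T -> T -> bool) b (i : T) (s : bool) : {set kq_point T} :=
  [set Some (j, s (+) sg i j) | j in b :\ i].

Lemma infty_signed_line (sg : T -> T -> bool) b i s :
  (None \in signed_line sg b i s) = false.
Proof. by apply/negP => /imsetP []. Qed.

Lemma in_signed_line (sg : T -> T -> bool) b i s p e :
  (Some (p, e) \in signed_line sg b i s) =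
  [&& p != i, p \in b & e == s (+) sg i p].
Proof.
apply/imsetP/idP => [[j]|/and3P [pi pb /eqP ->]].
  by rewrite !inE => /andP [ji jb] [-> ->]; rewrite ji jb eqxx.
by exists p; rewrite // !inE pi.
Qed.

Lemma infty_kq_triple (q : T) : None \in kq_triple q.
Proof. by rewrite !inE. Qed.

Lemma in_kq_triple (q p : T) e : (Some (p, e) \in kq_triple q) = (p == q).
Proof.
rewrite !inE /= /unprimed /primed !(inj_eq Some_inj) !xpair_eqE -andb_orr.
by case: e; rewrite andbT.
Qed.

Lemma infty_kq_block_points D : None \in kq_block_points D.
Proof. by rewrite !inE. Qed.

Lemma in_kq_block_points D p e : (Some (p, e) \in kq_block_points D) = (p \in D).
Proof.
rewrite !inE /=; apply/orP/idP => [[]/imsetP [q qD [-> _]] //|pD].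
by case: e; [right|left]; apply/imsetP; exists p.
Qed.

Lemma kq_block_pointsT : kq_block_points [set: T] = setT.
Proof.
by apply/setP => -[[p e]|]; rewrite ?in_kq_block_points ?infty_kq_block_points !inE.
Qed.

Lemma card_kq_block_points D : #|kq_block_points D| = 2 * #|D| + 1.
Proof.
have -> : kq_block_points D = None |: [set Some x | x in setX D [set: bool]].
  apply/setP => -[[p e]|]; last by rewrite infty_kq_block_points !inE.
  by rewrite in_kq_block_points !inE (mem_imset _ _ Some_inj) !inE andbT.
rewrite cardsU1 card_imset; last exact: Some_inj.
rewrite cardsX cardsT card_bool mulnC addnC.
by case: imsetP => [[]|].
Qed.

Definition kq_class (sg : {set T} -> T -> T -> bool) (Q : {set {set T}}) (q : T) :
    {set {set kq_point T}} :=
  kq_triple q |: [set signed_line (sg p.1) p.1 q p.2 |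
    p : {set T} * bool & (p.1 \in Q) && (q \in p.1)].

Definition kq_classes sg Q D : {set {set {set kq_point T}}} :=
  [set kq_class sg Q q | q in D].

Definition kq_triples sg Q D : {set {set kq_point T}} :=
  \bigcup_(q in D) kq_class sg Q q.

Lemma kq_classP sg Q q t :
  reflect (t = kq_triple q \/
           exists b s, [/\ b \in Q, q \in b & t = signed_line (sg b) b q s])
          (t \in kq_class sg Q q).
Proof.
rewrite !inE; apply: (iffP orP) => -[/eqP|]; first by left.
- by move/imsetP => [[b s]]; rewrite inE /= => /andP [bQ qb] ->; right; exists b, s.
- by left.
- by move=> [b [s [bQ qb ->]]]; right; apply/imsetP; exists (b, s); rewrite // inE bQ qb.
Qed.

Variables (sg : {set T} -> T -> T -> bool) (D : {set T}) (Q : {set {set T}}).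
Hypothesis Qsteiner : steiner 4 D Q.

Let blockD b q : b \in Q -> q \in b -> q \in D.
Proof. by move=> bQ; have [/subsetP + _] := proj1 Qsteiner b bQ; apply. Qed.

Let card_blockD1 b q : b \in Q -> q \in b -> #|b :\ q| = 3.
Proof.
by move=> bQ qb; have [_] := proj1 Qsteiner b bQ; rewrite (cardsD1 q) qb => -[].
Qed.

Lemma kq_triplesP t :
  reflect ((exists2 q, q \in D & t = kq_triple q) \/
           exists b q s, [/\ b \in Q, q \in b & t = signed_line (sg b) b q s])
          (t \in kq_triples sg Q D).
Proof.
apply: (iffP bigcupP) => [[q qD /kq_classP [->|[b [s [bQ qb ->]]]]]|].
- by left; exists q.
- by right; exists b, q, s.
- move=> [[q qD ->]|[b [q [s [bQ qb ->]]]]]; exists q => //.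
  + by apply/kq_classP; left.
  + exact: blockD qb.
  + by apply/kq_classP; right; exists b, s.
Qed.

Lemma kq_class_subset q t : q \in D -> t \in kq_class sg Q q ->
  t \subset kq_block_points D /\ #|t| = 3.
Proof.
move=> qD /kq_classP [->|[b [s [bQ qb ->]]]]; split.
- apply/subsetP => -[[p e]|_]; last exact: infty_kq_block_points.
  by rewrite in_kq_triple in_kq_block_points => /eqP ->.
- rewrite /kq_triple -setUA cardsU1 cards2 !inE.
  by rewrite /unprimed /primed (inj_eq Some_inj) xpair_eqE andbF.
- apply/subsetP => -[[p e]|]; last by rewrite infty_signed_line.
  by rewrite in_signed_line in_kq_block_points => /and3P [_ /(blockD bQ)].
- by rewrite card_imset ?card_blockD1 // => j k [].
Qed.

(** A point over [p != q] lies only on lines of the block through [p] and [q], and its sign selects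
    one of the two lines of direction [q]. The points over [q] and infinity are left to
    [kq_triple q]. *)
Lemma kq_class_partition q : q \in D ->
  partition (kq_class sg Q q) (kq_block_points D).
Proof.
move=> qD; apply: partition_unique => [A /(kq_class_subset qD) [sA A3]|[[p e]|]|].
- by rewrite -card_gt0 A3.
- rewrite in_kq_block_points => pD; have [->|pq] := eqVneq p q.
    by exists (kq_triple q); [apply/kq_classP; left | rewrite in_kq_triple].
  have [b [bQ pb qb]] := steiner_block_ex Qsteiner pD qD pq.
  exists (signed_line (sg b) b q (e (+) sg b q p)).
    by apply/kq_classP; right; exists b, (e (+) sg b q p).
  by rewrite in_signed_line pq pb addbK /=.
- by move=> _; exists (kq_triple q); [apply/kq_classP; left | rewrite infty_kq_triple].
move=> A B [[p e]|] /kq_classP [->|[b [s [bQ qb ->]]]]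
    /kq_classP [->|[b' [s' [b'Q qb' ->]]]] //; rewrite ?infty_signed_line //;
    rewrite ?in_kq_triple ?in_signed_line.
- by move=> /eqP ->; rewrite eqxx.
- by move=> /and3P [/negbTE ->].
move=> /and3P [pq pb /eqP ->] /and3P [_ pb' /eqP].
have <- := steiner_block_inj Qsteiner pq bQ b'Q pb qb pb' qb'.
by move=> /addIb ->.
Qed.

Hypothesis Qcover : forall q, q \in D -> exists2 b, b \in Q & q \in b.
Hypothesis Qsign : forall b, b \in Q -> sign_table b (sg b).

(** The point is that a triple determines its class. A triple through infinity shows [q]; a line
    projects onto three points, two of which determine the block, and [q] is the point of the block
    that is missed. *)
Lemma kq_classes_partition : partition (kq_classes sg Q D) (kq_triples sg Q D).
Proof.
apply: partition_unique => [_ /imsetP [q qD ->]|t /bigcupP [q qD tq]|].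
- split; first exact: bigcup_sup.
  by apply/set0Pn; exists (kq_triple q); apply/kq_classP; left.
- by exists (kq_class sg Q q) => //; apply: imset_f.
move=> _ _ t /imsetP [q qD ->] /imsetP [q' q'D ->].
move=> /kq_classP [->|[b [s [bQ qb ->]]]] /kq_classP [E|[b' [s' [b'Q qb' E]]]].
- suff -> : q = q' by [].
  by apply/eqP; rewrite -(in_kq_triple q' q true) -E in_kq_triple.
- by have := infty_kq_triple q; rewrite E infty_signed_line.
- by have := infty_kq_triple q'; rewrite -E infty_signed_line.
suff -> : q = q' by [].
have Eb p : (p \in b :\ q) = (p \in b' :\ q').
  have /setP EE := E; rewrite !inE; apply/andP/andP => -[pq pb].
    have := EE (Some (p, s (+) sg b q p)).
    by rewrite !in_signed_line pq pb eqxx => /esym/and3P [].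
  have := EE (Some (p, s' (+) sg b' q' p)).
  by rewrite !in_signed_line pq pb eqxx => /and3P [].
have /card_gt1P [x [y [xbq ybq nexy]]] : 1 < #|b :\ q| by rewrite card_blockD1.
have [/setD1P [_ xb] /setD1P [_ yb]] := (xbq, ybq).
move: xbq ybq; rewrite !Eb => /setD1P [_ xb'] /setD1P [_ yb'].
have Ebb := steiner_block_inj Qsteiner nexy bQ b'Q xb yb xb' yb'.
apply/eqP; have := Eb q; rewrite !inE eqxx -Ebb qb andbT /=.
by case: eqP.
Qed.

(** Two points over distinct [p] and [p'] force the block; the sign table at the sum of their signs
    then gives the direction, and either point fixes the sign of the line. Any other pair lies in
    one [kq_triple] and on no line. *)
Lemma kq_triples_steiner : steiner 3 (kq_block_points D) (kq_triples sg Q D).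
Proof.
split=> [t /bigcupP [q qD /(kq_class_subset qD)] //|].
have single x y t : t \in kq_triples sg Q D -> x \in t -> y \in t ->
    (forall t', t' \in kq_triples sg Q D -> x \in t' -> y \in t' -> t' = t) ->
    #|[set t in kq_triples sg Q D | (x \in t) && (y \in t)]| = 1.
  move=> tB xt yt un; apply/eqP/cards1P; exists t; apply/setP => t'; rewrite !inE.
  apply/and3P/eqP => [[]|->]; [exact: un | by split].
have tripleB q : q \in D -> kq_triple q \in kq_triples sg Q D.
  by move=> qD; apply/kq_triplesP; left; exists q.
have withinf p e : p \in D ->
    #|[set t in kq_triples sg Q D | (None \in t) && (Some (p, e) \in t)]| = 1.
  move=> pD; apply: (single _ _ (kq_triple p)); rewrite ?tripleB ?infty_kq_triple //.
    by rewrite in_kq_triple.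
  move=> t /kq_triplesP [[q qD ->]|[b [q [s [bQ qb ->]]]]] //.
    by rewrite in_kq_triple => _ /eqP ->.
  by rewrite infty_signed_line.
move=> [[p e]|] [[p' e']|]; rewrite ?in_kq_block_points //; last by move=> _ /withinf.
  move=> pD p'D; have [->|nep] := eqVneq p p'.
    move=> nee; apply: (single _ _ (kq_triple p')); rewrite ?tripleB ?in_kq_triple //.
    move=> t /kq_triplesP [[q qD ->]|[b [q [s [bQ qb ->]]]]].
      by rewrite in_kq_triple => /eqP ->.
    rewrite !in_signed_line => /and3P [_ _ /eqP E] /and3P [_ _ /eqP E'].
    by rewrite E E' eqxx in nee.
  move=> _; have [b [bQ pb p'b]] := steiner_block_ex Qsteiner pD p'D nep.
  have [i iP] := Qsign bQ (e (+) e') pb p'b nep.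
  have /and4P [ib ip ip' /eqP sgi] := etrans (iP i) (eqxx i).
  apply: (single _ _ (signed_line (sg b) b i (e (+) sg b i p))).
  - by apply/kq_triplesP; right; exists b, i, (e (+) sg b i p).
  - by rewrite in_signed_line eq_sym ip pb addbK eqxx.
  - rewrite in_signed_line eq_sym ip' p'b -addbA sgi addbA addbb.
    by rewrite addFb eqxx.
  move=> t /kq_triplesP [[q qD ->]|[b' [q [s [b'Q qb' ->]]]]].
    by rewrite !in_kq_triple => /eqP E /eqP E'; rewrite E E' eqxx in nep.
  rewrite !in_signed_line => /and3P [pq pb' /eqP Ee] /and3P [p'q p'b' /eqP Ee'].
  have Eb := steiner_block_inj Qsteiner nep bQ b'Q pb p'b pb' p'b'.
  (* Adding the two sign equations cancels [s], so [q] has the property that singles out [i]. *)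
  subst b'; have Eq : q = i.
    apply/eqP; rewrite -iP qb' eq_sym pq eq_sym p'q Ee Ee' /=.
    by case: s {Ee Ee'}; case: (sg b q p); case: (sg b q p').
  by subst q; rewrite Ee addbK.
by under eq_finset => t do rewrite [(_ \in t) && _]andbC; move=> pD _ _; apply: withinf.
Qed.

Lemma kq_kirkman : kirkman_triple_system (2 * #|D| + 1) (kq_block_points D)
  (kq_triples sg Q D) (kq_classes sg Q D).
Proof.
split; first exact: card_kq_block_points.
- exact: kq_triples_steiner.
- exact: kq_classes_partition.
- by move=> _ /imsetP [q qD ->]; apply: kq_class_partition.
Qed.

Lemma kq_triples_infty :
  [set t in kq_triples sg Q D | infty T \in t] = [set kq_triple q | q in D].
Proof.
apply/setP => t; rewrite inE; apply/andP/imsetP => [[/kq_triplesP []]|].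
- by [].
- by move=> [b [q [s [_ _ ->]]]]; rewrite infty_signed_line.
move=> [q qD ->]; rewrite infty_kq_triple; split=> //.
by apply/kq_triplesP; left; exists q.
Qed.

(** Gives the union of placements that [is_KQ] asks for. Each line belongs to its block, and
    [Qcover] supplies a block for each triple through infinity. *)
Lemma kq_triples_bigcup :
  kq_triples sg Q D = \bigcup_(b in Q) kq_triples sg [set b] b.
Proof.
apply/setP => t; apply/kq_triplesP/bigcupP.
  move=> [[q qD ->]|[b [q [s [bQ qb ->]]]]].
    have [b bQ qb] := Qcover qD; exists b => //.
    by apply/bigcupP; exists q => //; apply/kq_classP; left.
  exists b => //; apply/bigcupP; exists q => //.
  by apply/kq_classP; right; exists b, s; rewrite inE.
move=> [b bQ /bigcupP [q qb /kq_classP [->|[b' [s [/set1P -> _ ->]]]]]].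
  by left; exists q => //; apply: blockD qb.
by right; exists b, q, s.
Qed.

End Construction.

(** * Colouring, choice of the tables and conclusion *)

Lemma kq_triples_colourable (T : finType) (D : {set T}) Q sg d (c : T -> 'I_d) :
  0 < d -> steiner 4 D Q ->
  (forall b i, b \in Q -> i \in b -> exists j k,
     [/\ j \in b :\ i, k \in b :\ i & (c j != c k) || (sg b i j != sg b i k)]) ->
  colourable (2 * d) (kq_triples sg Q D).
Proof.
move=> d0 Qst nonmono.
have cardE : #|{: 'I_d * bool}| = 2 * d by rewrite card_prod card_ord card_bool mulnC.
(* The colour of infinity is an arbitrary default: a triple through infinity also contains [q] and
   [q'], whose colours differ in the second component. *)
pose f (x : kq_point T) := if x is Some (p, e) then (c p, e) else (Ordinal d0, false).
exists (fun x => cast_ord cardE (enum_rank (f x))) => t tB [col mono].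
have {mono} feq x y : x \in t -> y \in t -> f x = f y.
  by move=> xt yt; apply/enum_rank_inj/(@cast_ord_inj _ _ cardE); rewrite !mono.
move/(kq_triplesP _ Qst): tB => [[q qD Et]|[b [q [s [bQ qb Et]]]]].
  have := feq (Some (q, true)) (Some (q, false)).
  by rewrite Et !in_kq_triple eqxx => /(_ isT isT).
have [j [k [jb kb ne]]] := nonmono b q bQ qb.
have := feq (Some (j, s (+) sg b q j)) (Some (k, s (+) sg b q k)).
move: jb kb; rewrite Et !in_signed_line !inE !eqxx => /andP [-> ->] /andP [-> ->].
move=> /(_ isT isT) [Ec /addbI Es].
by rewrite Ec Es !eqxx in ne.
Qed.

Theorem theorem6p3 (delta v : nat) (T : finType) (Q : {set {set T}})
    (hdelta : 2 <= delta) (hv : v != 1)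
    (hQ : quadruple_system v [set: T] Q)
    (hcol : colourable delta Q) :
  exists (B : {set {set kq_point T}}) (R : {set {set {set kq_point T}}}),
    [/\ is_KQ Q B R,
        kirkman_triple_system (2 * v + 1) [set: kq_point T] B R
      & colourable (2 * delta) B].
Proof.
move: hQ hcol => [cardT Qst] [c cP].
have Qcard b : b \in Q -> #|b| = 4 by move=> /(proj1 Qst) [].
(* Order 1 is excluded here: a single point would lie in no block, and its triple through infinity
   would be in no placement. *)
have Qcover q : q \in [set: T] -> exists2 b, b \in Q & q \in b.
  move=> _; have : 1 < #|[set: T]|.
    have : 0 < #|[set: T]| by apply/card_gt0P; exists q.
    by rewrite cardT; case: v hv {cardT} => [|[]].
  rewrite (cardsD1 q) inE /= add1n ltnS => /card_gt0P [p]; rewrite !inE andbT => nepq.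
  have [b [bQ _ qb]] := steiner_block_ex Qst (in_setT p) (in_setT q) nepq.
  by exists b.
have [sg sgP] : exists sg, forall b, b \in Q -> sign_table b (sg b) /\
    forall i, i \in b -> exists j k,
     [/\ j \in b :\ i, k \in b :\ i & (c j != c k) || (sg b i j != sg b i k)].
  (* The table is chosen separately for each block. The choice ranges over all subsets of [T], so
     those outside [Q] get a dummy table. *)
  apply: (@fin_all_exists _ (fun _ => T -> T -> bool) (fun b sg => b \in Q ->
    sign_table b sg /\ forall i, i \in b -> exists j k,
    [/\ j \in b :\ i, k \in b :\ i & (c j != c k) || (sg i j != sg i k)])) => b.
  have [bQ|nbQ] := boolP (b \in Q); last by exists (fun _ _ => false).
  have [p [p' [pb p'b nec]]] : exists p p', [/\ p \in b, p' \in b & c p != c p'].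
    have /card_gt0P [p pb] : 0 < #|b| by rewrite Qcard.
    have [/exists_inP [p' p'b ne]|/exists_inPn all] := boolP [exists p' in b, c p != c p'].
      by exists p, p'.
    case: (cP b bQ); exists (c p) => p' /all; rewrite negbK => /eqP //.
  (* Taking [x] away from both [p] and [p'] keeps two colours on [b :\ x], where the row of signs is
     constant. *)
  have /card_gt0P [x] : 0 < #|b :\ p :\ p'|.
    have := Qcard b bQ; rewrite (cardsD1 p) pb (cardsD1 p').
    by case: (_ \in _); case: #|_|.
  rewrite !inE => /and3P [xp' xp xb].
  have [sg sgt sgx] := sign_table_ex (Qcard b bQ) xb.
  exists sg => _; split=> // i ib; have [->|neix] := eqVneq i x.
    by exists p, p'; rewrite !inE eq_sym xp pb eq_sym xp' p'b nec.
  have [j [k [jb kb ne]]] := sgx i ib neix.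
  by exists j, k; rewrite jb kb ne orbT.
have Qsign b : b \in Q -> sign_table b (sg b) by move=> /sgP [].
have KT := kq_kirkman Qst Qsign; rewrite kq_block_pointsT cardT in KT.
exists (kq_triples sg Q setT), (kq_classes sg Q setT); split=> //.
  split; first by have [_ ? ? ?] := KT; split; rewrite ?cardsT.
  exists (fun b => kq_triples sg [set b] b); split.
    move=> b bQ; have bst := steiner_restrict Qst bQ; split.
      exists (kq_classes sg [set b] b).
      have <- : 2 * #|b| + 1 = 9 by rewrite Qcard.
      by apply: (kq_kirkman bst) => b' /set1P ->; apply: Qsign.
    exact: kq_triples_infty bst.
  exact: kq_triples_bigcup Qst Qcover.
apply: (@kq_triples_colourable _ _ _ _ _ c) => //; first exact: ltnW.
by move=> b i /sgP [_]; apply.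
Qed.
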